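(* Let $n\ge 2$, let $m\ge 2$ and let $T=\{E_1,E_2,\dots,E_m\}$ be a strongly independent system of equations in the unknowns $x_1,\dots,x_n$. Then $m\le |E_1|+|E_2|+2$, and there exist indices $1\le k<\ell\le n$ such that $m\le 2(|E_1|_{x_k}+|E_1|_{x_\ell})+2$. If moreover $T$ has a solution of rank $n-1$, then $m\le |E_1|+|E_2|+1$, and there exist indices $1\le k<\ell\le n$ such that $m\le 2(|E_1|_{x_k}+|E_1|_{x_\ell})+1$.
   Context: Unknowns $\Xi=\{x_1,\dots,x_n\}$. An equation is a pair $E=(u,v)$ of words $u,v\in\Xi^*$; $|E|=|u|+|v|$ and $|E|_{x}=|u|_x+|v|_x$, where $|w|_x$ is the number of occurrences of $x$ in $w$. A solution of a system of equations is a monoid morphism $h:\Xi^*\to\Sigma^*$ ($\Sigma=\{a_1,\dots,a_k\}$ a finite alphabet) with $h(u)=h(v)$ for every equation $(u,v)$ of the system. For such $h$ let $\gamma(h)_i=(|h(x_1)|_{a_i},\dots,|h(x_n)|_{a_i})\in\mathbb Q^n$ ($i=1,\dots,k$), let $\Gamma_h$ be the $\mathbb Q$-linear span of $\gamma(h)_1,\dots,\gamma(h)_k$, and define the rank of $h$ to be $\dim\Gamma_h$. A system $T$ of equations in $n$ unknowns is strongly independent if every proper subsystem of $T$ has a solution of rank $n-1$ that is not a solution of $T$. *)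

(* Defs.v *)
From HB Require Import structures.
From mathcomp Require Import all_boot all_order all_algebra.
Set Implicit Arguments. Unset Strict Implicit. Unset Printing Implicit Defensive.
Import Order.TTheory GRing.Theory Num.Theory.

Definition word (n : nat) := seq 'I_n.
Definition equation (n : nat) := (word n * word n)%type.

Definition eq_len n (E : equation n) : nat := size E.1 + size E.2.
Definition eq_occ n (E : equation n) (x : 'I_n) : nat :=
  count_mem x E.1 + count_mem x E.2.

(* A morphism h : Xi^* -> Sigma^*, Sigma = {a_1..a_k} = 'I_k, is given by
   the images of the unknowns; its extension to words. *)
Definition morph_apply n k (h : 'I_n -> seq 'I_k) (w : word n) : seq 'I_k :=
  flatten (map h w).

Definition is_solution_eq n k (h : 'I_n -> seq 'I_k) (E : equation n) : Prop :=
  morph_apply h E.1 = morph_apply h E.2.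

Definition is_solution_sys n k m (h : 'I_n -> seq 'I_k) (E : 'I_m -> equation n)
  (S : {set 'I_m}) : Prop :=
  forall i, i \in S -> is_solution_eq h (E i).

Definition gamma_mx n k (h : 'I_n -> seq 'I_k) : 'M[rat]_(k, n) :=
  \matrix_(i < k, j < n) ((count_mem i (h j))%:R)%R.

Definition morph_rank n k (h : 'I_n -> seq 'I_k) : nat := \rank (gamma_mx h).

Definition strongly_independent n m (E : 'I_m -> equation n) : Prop :=
  forall S : {set 'I_m}, S \proper [set: 'I_m] ->
    exists (k : nat) (h : 'I_n -> seq 'I_k),
      [/\ is_solution_sys h E S, morph_rank h = n.-1
        & ~ is_solution_sys h E [set: 'I_m]].

Definition has_solution_of_rank n m (E : 'I_m -> equation n) (r : nat) : Prop :=
  exists (k : nat) (h : 'I_n -> seq 'I_k),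
    is_solution_sys h E [set: 'I_m] /\ morph_rank h = r.

(* Main.v *)
Require Import Defs.
From HB Require Import structures.
From mathcomp Require Import all_boot all_order all_algebra.
From mathcomp Require Import mpoly ring lra zify.

(* The Fox derivatives of the two sides of an equation E turn "h solves E" into
   linear equations satisfied by the Fox derivatives of the words h(x).  When h
   has rank n-1 these equations have a one-dimensional solution space, so any
   two equations solved by h have proportional Fox vectors once the unknowns are
   specialised according to h.  Let M be a nonzero 2x2 minor, in columns k and l,
   of the formal Fox vectors of E_1 and E_2, and let d be a normal vector of
   Gamma_h for a common solution h of E_1 and E_2 of rank n-1.  Modulo d the
   minor vanishes, hence no linear functional orthogonal to d has a unique
   minimiser on the support of M.

   By strong independence m-2 (respectively m-1) such normals are pairwise
   non-parallel, and at most one of them comes from an h that erases an unknown.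
   The others are orthogonal to positive functionals, so r of their hyperplanes
   cut the open orthant into at least r+1 regions, and generic functionals from
   different regions have different unique minimisers on the support of M.  The
   prefixes of a word form a chain, so the support of M is covered by
   2(|E_1|_k + |E_1|_l) chains of monomials, each of which contains at most one
   such minimiser.  Exchanging E_1 and E_2 and averaging gives the bound by
   |E_1| + |E_2|. *)

Set Implicit Arguments.
Unset Strict Implicit.
Unset Printing Implicit Defensive.
Import Order.TTheory GRing.Theory Num.Theory.

(** * Fox derivatives *)

Section Fox.
Local Open Scope ring_scope.

Variable R : comNzRingType.

Definition word_val n (v : 'I_n -> R) (w : word n) : R := \prod_(y <- w) v y.

(** Abelianised Fox derivative of free differential calculus: each occurrence of [x] contributes the
    value of the prefix before it. *)
Fixpoint fox n (v : 'I_n -> R) (x : 'I_n) (w : word n) : R :=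
  if w is y :: w' then (y == x)%:R + v y * fox v x w' else 0.

Definition fox_eq n (v : 'I_n -> R) (E : equation n) (x : 'I_n) : R :=
  fox v x E.1 - fox v x E.2.

Lemma eq_fox n (v v' : 'I_n -> R) x w : v =1 v' -> fox v x w = fox v' x w.
Proof. by move=> vv'; elim: w => //= y w ->; rewrite vv'. Qed.

Lemma fox_cat n (v : 'I_n -> R) x u w :
  fox v x (u ++ w) = fox v x u + word_val v u * fox v x w.
Proof.
elim: u => [|y u IHu] /=; first by rewrite /word_val big_nil mul1r add0r.
by rewrite IHu /word_val big_cons; ring.
Qed.

(** Chain rule of Fox calculus. *)
Lemma fox_morph n k (v : 'I_k -> R) (h : 'I_n -> seq 'I_k) a w :
  fox v a (morph_apply h w)
  = \sum_x fox (fun x => word_val v (h x)) x w * fox v a (h x).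
Proof.
elim: w => [|y w IHw] /=; first by rewrite big1 // => x _; rewrite mul0r.
rewrite /morph_apply /= fox_cat -/(morph_apply h w) IHw mulr_sumr.
rewrite [RHS](eq_bigr (fun x => (y == x)%:R * fox v a (h x) +
  word_val v (h y) * (fox (fun x => word_val v (h x)) x w * fox v a (h x)))).
  rewrite big_split /= [in RHS](bigD1 y) //= eqxx mul1r [in RHS]big1 ?addr0 // => x.
  by rewrite eq_sym => /negPf ->; rewrite mul0r.
by move=> x _; ring.
Qed.

Lemma fox_eq_morph n k (v : 'I_k -> R) (h : 'I_n -> seq 'I_k) (E : equation n) a :
  fox v a (morph_apply h E.1) - fox v a (morph_apply h E.2)
  = \sum_x fox_eq (fun x => word_val v (h x)) E x * fox v a (h x).
Proof.
rewrite !fox_morph -sumrB; apply: eq_bigr => x _.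
by rewrite /fox_eq mulrBl.
Qed.

(** Fundamental formula of Fox calculus: the sum telescopes along the prefixes of [w]. *)
Lemma fox_fundamental n (v : 'I_n -> R) w :
  \sum_x fox v x w * (v x - 1) = word_val v w - 1.
Proof.
elim: w => [|y w IHw] /=.
  by rewrite /word_val big_nil subrr big1 // => x _; rewrite mul0r.
rewrite (eq_bigr (fun x => (y == x)%:R * (v x - 1) +
  v y * (fox v x w * (v x - 1)))); last by move=> x _; ring.
rewrite big_split /= -mulr_sumr IHw (bigD1 y) //= eqxx mul1r big1 ?addr0 => [|x].
  by rewrite /word_val big_cons; ring.
by rewrite eq_sym => /negPf ->; rewrite mul0r.
Qed.

End Fox.

Lemma rmorph_fox (R S : comNzRingType) (f : {rmorphism R -> S}) n (v : 'I_n -> R) x w :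
  f (fox v x w) = fox (fun i => f (v i)) x w.
Proof.
elim: w => [|y w IHw] /=; first exact: rmorph0.
by rewrite rmorphD rmorphM rmorph_nat IHw.
Qed.

Lemma rmorph_fox_eq (R S : comNzRingType) (f : {rmorphism R -> S}) n
  (v : 'I_n -> R) E x :
  f (fox_eq v E x) = fox_eq (fun i => f (v i)) E x.
Proof. by rewrite /fox_eq rmorphB !rmorph_fox. Qed.

(** * Recovering a word from its Fox derivatives *)

Section FoxPoly.
Local Open Scope ring_scope.

Definition monom_val n (L : 'I_n -> nat) (i : 'I_n) : {poly rat} := 'X^(L i).

Lemma fox_poly_coef0_ge0 n (L : 'I_n -> nat) x w : 0 <= (fox (monom_val L) x w)`_0.
Proof.
elim: w => [|y w IHw] /=; first by rewrite coef0.
rewrite coefD -polyC_natr coefC /= coefXnM.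
by apply: addr_ge0; first exact: ler0n; case: ifP => //; rewrite subn0.
Qed.

Lemma fox_poly_coef0_head n (L : 'I_n -> nat) x w :
  (fox (monom_val L) x (x :: w))`_0 != 0.
Proof.
rewrite gt_eqF //= eqxx coefD coef1 coefXnM ltr_pwDl //.
by case: ifP => // _; rewrite sub0n fox_poly_coef0_ge0.
Qed.

Lemma fox_poly_coef0_neq n (L : 'I_n -> nat) x y w : L x != 0%N -> x != y ->
  (fox (monom_val L) y (x :: w))`_0 = 0.
Proof.
by move=> Lx /negPf /= ->; rewrite add0r coefXnM lt0n Lx.
Qed.

(* If the first letters differ, one of them, say [x], has positive weight, and
   then only one of the words contributes a constant term for the other letter. *)
Lemma fox_poly_inj n (L : 'I_n -> nat) (u w : word n) :
  (forall x y, L x = 0 -> L y = 0 -> x = y)%N ->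
  (forall x, fox (monom_val L) x u = fox (monom_val L) x w) -> u = w.
Proof.
move=> L0; wlog: u w / (size u <= size w)%N => [hw|].
  by case: (leqP (size u) (size w)) => [/hw//|/ltnW /hw uw fx]; rewrite uw.
elim: u w => [|x u IHu] [|y w] //= szuw fox_uw.
  by have := fox_poly_coef0_head L y w; rewrite -[fox _ _ _]fox_uw coef0 eqxx.
have [eq_xy|neq_xy] := eqVneq x y.
  rewrite -eq_xy; congr (_ :: _); apply: IHu => // z.
  move: (fox_uw z); rewrite -eq_xy => /addrI.
  by apply: mulfI; rewrite monic_neq0 // monicXn.
have [Lx|Ly] : (L x != 0)%N \/ (L y != 0)%N.
- have [Lx|] := eqVneq (L x) 0%N; last by left.
  have [Ly|] := eqVneq (L y) 0%N; last by right.
  by rewrite (L0 _ _ Lx Ly) eqxx in neq_xy.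
- have fxy : fox (monom_val L) y (x :: u) = fox (monom_val L) y (y :: w) := fox_uw y.
  by have := fox_poly_coef0_head L y w; rewrite -fxy fox_poly_coef0_neq ?eqxx.
- have fxy : fox (monom_val L) x (x :: u) = fox (monom_val L) x (y :: w) := fox_uw x.
  have := fox_poly_coef0_head L x u.
  by rewrite fxy fox_poly_coef0_neq ?eqxx // eq_sym.
Qed.

End FoxPoly.

(** * Relations of matrices of corank one *)

Section Corank1.
Local Open Scope ring_scope.

Lemma mxrank_mxsub (K : fieldType) m n p q (f : 'I_p -> 'I_m) (g : 'I_q -> 'I_n)
  (A : 'M[K]_(m, n)) : (\rank (mxsub f g A) <= \rank A)%N.
Proof.
rewrite mxsubrc (leq_trans (mxrankS (rowsub_sub _ _))) //.
by rewrite -mxrank_tr trmx_mxsub -[leqRHS]mxrank_tr mxrankS // rowsub_sub.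
Qed.

Lemma det_mx2 (K : comNzRingType) (A : 'M[K]_2) :
  \det A = A 0 0 * A 1 1 - A 0 1 * A 1 0.
Proof.
have -> : 1 = lift 0 0 :> 'I_2 by apply: val_inj.
rewrite (expand_det_row _ 0) !big_ord_recl big_ord0 addr0 /cofactor !det_mx11 !mxE.
have -> : lift (lift 0 0) 0 = 0 :> 'I_2 by apply: val_inj.
by rewrite /= expr0 expr1; ring.
Qed.

(** Two non-proportional relations would form a matrix of rank 2 killed by [F^T], and the two ranks
    would add up to more than [n]. *)
Lemma corank1_minor (K : fieldType) k n (F : 'M[K]_(k, n)) (s t : 'I_n -> K) x y :
  (n.-1 <= \rank F)%N ->
  (forall a, \sum_x s x * F a x = 0) -> (forall a, \sum_x t x * F a x = 0) ->
  s x * t y = s y * t x.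
Proof.
move=> rkF Fs Ft; apply/eqP; rewrite -subr_eq0; apply/negPn/negP => nz.
pose S : 'M[K]_(2, n) := \matrix_(i, j) if i == 0 then s j else t j.
have SF0 : S *m F^T = 0.
  apply/matrixP=> i a; rewrite !mxE.
  under eq_bigr do rewrite !mxE.
  by case: (i == 0).
have := mulmx0_rank_max SF0; rewrite mxrank_tr.
suff rkS : (2 <= \rank S)%N.
  by have := leq_ltn_trans (leq0n x) (ltn_ord x); move: rkF rkS; clear; lia.
have unitS : colsub (fun i : 'I_2 => if i == 0 then x else y) S \in unitmx.
  by rewrite unitmxE det_mx2 !mxE /= unitfE.
by rewrite -[leqLHS](mxrank_unit unitS) mxrank_mxsub.
Qed.

(** A minor that is nonzero at [c] is nonzero as a polynomial. *)
Lemma mxrank_horner (F : fieldType) k n (A : 'M[{poly F}]_(k, n)) (c : F) :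
  (\rank (map_mx (horner_eval c) A) <= \rank (map_mx (@FracField.tofrac _) A))%N.
Proof.
set B := map_mx _ A; pose f := maxrankfun B.
have fullB : row_full (rowsub f B)^T.
  by rewrite /row_full mxrank_tr; apply: maxrowsub_free.
pose g := fullrankfun fullB.
have : mxsub f g B \in unitmx.
  have -> : mxsub f g B = (rowsub g (rowsub f B)^T)^T by apply/matrixP=> i j; rewrite !mxE.
  by rewrite unitmx_tr fullrowsub_unit.
rewrite -map_mxsub unitmxE det_map_mx unitfE => detB.
have unitA : map_mx (@FracField.tofrac _) (mxsub f g A) \in unitmx.
  rewrite unitmxE det_map_mx unitfE tofrac_eq0.
  by apply: contraNneq detB => ->; rewrite rmorph0.
by rewrite -[leqLHS](mxrank_unit unitA) map_mxsub mxrank_mxsub.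
Qed.

Lemma corank1_minor_poly (F : fieldType) k n (A : 'M[{poly F}]_(k, n)) c
  (s t : 'I_n -> {poly F}) x y :
  (n.-1 <= \rank (map_mx (horner_eval c) A))%N ->
  (forall a, \sum_x s x * A a x = 0) -> (forall a, \sum_x t x * A a x = 0) ->
  s x * t y = s y * t x.
Proof.
move=> rkA As At; apply/eqP; rewrite -tofrac_eq !tofracM; apply/eqP.
have killed (r : 'I_n -> {poly F}) a : \sum_x r x * A a x = 0 ->
  \sum_x FracField.tofrac (r x) * map_mx (@FracField.tofrac _) A a x = 0.
  move=> r0; transitivity (FracField.tofrac (\sum_x r x * A a x)).
    by rewrite rmorph_sum /=; apply: eq_bigr => z _; rewrite mxE tofracM.
  by rewrite r0 tofrac0.
apply: (corank1_minor (s := fun z => FracField.tofrac (s z))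
  (t := fun z => FracField.tofrac (t z)) _ _ (leq_trans rkA (mxrank_horner _ _))).
- by move=> a; apply: killed.
- by move=> a; apply: killed.
Qed.

End Corank1.

(** * Solutions of maximal rank *)

Section Solutions.
Local Open Scope ring_scope.

Definition weight k (w : 'I_k -> nat) (u : word k) : nat := (\sum_(y <- u) w y)%N.

Lemma word_val_monom k (w : 'I_k -> nat) u :
  word_val (monom_val w) u = 'X^(weight w u).
Proof. by rewrite /word_val /weight -prodrXr. Qed.

Lemma weight_eq0 k (w : 'I_k -> nat) u : (forall a, 0 < w a)%N ->
  weight w u = 0%N -> u = [::].
Proof.
by move=> w_gt0; case: u => // a u; rewrite /weight big_cons; have := w_gt0 a; lia.
Qed.

(** At 1 all prefixes have value one, so the Fox Jacobian of [h] specialises to [gamma_mx h]; this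
    carries the rank of [h] over to polynomials. *)
Lemma fox_monom_horner1 k (w : 'I_k -> nat) a u :
  (fox (monom_val w) a u).[1] = (count_mem a u)%:R.
Proof.
elim: u => [|y u IHu] /=; first by rewrite horner0.
by rewrite hornerD hornerM hornerXn expr1n mul1r IHu natrD -polyC_natr hornerC.
Qed.

Lemma fox_filter (R : comNzRingType) m (v : 'I_m -> R) (b : pred 'I_m) x u : b x ->
  (forall y, ~~ b y -> v y = 1) -> fox v x (filter b u) = fox v x u.
Proof.
move=> bx v1; elim: u => //= y u IHu.
case: ifPn => [_|nby] /=; first by rewrite IHu.
rewrite IHu v1 // mul1r; have [yx|] := eqVneq y x; last by rewrite add0r.
by rewrite yx bx in nby.
Qed.

Lemma fox_notin (R : comNzRingType) m (v : 'I_m -> R) x u : x \notin u -> fox v x u = 0.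
Proof.
elim: u => //= y u IHu; rewrite in_cons negb_or eq_sym => /andP[/negPf -> /IHu ->].
by rewrite mulr0 addr0.
Qed.

Section Weighted.

Variables (n k : nat) (h : 'I_n -> seq 'I_k) (w : 'I_k -> nat).
Hypothesis w_gt0 : forall a, (0 < w a)%N.

Let L x := weight w (h x).

(** Kernel of the Fox Jacobian of [h]. *)
Definition killed (s : 'I_n -> {poly rat}) : Prop :=
  forall a, \sum_x s x * fox (monom_val w) a (h x) = 0.

(** By the chain rule, being killed means that the two image words have the same Fox derivatives.
    These determine the words, since all letters of the target alphabet have positive weight. *)
Lemma is_solution_eq_killed E : is_solution_eq h E <-> killed (fox_eq (monom_val L) E).
Proof.
have foxE a : \sum_x fox_eq (monom_val L) E x * fox (monom_val w) a (h x) =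
    fox (monom_val w) a (morph_apply h E.1) - fox (monom_val w) a (morph_apply h E.2).
  rewrite fox_eq_morph; apply: eq_bigr => x _; congr (_ * _).
  by rewrite /fox_eq; congr (_ - _); apply: eq_fox => y; rewrite word_val_monom.
split=> [solE a|kE]; first by rewrite foxE solE subrr.
apply: (@fox_poly_inj _ w) => [x y wx0|a]; first by have := w_gt0 x; rewrite wx0.
by apply/eqP; rewrite -subr_eq0 -foxE kE.
Qed.

Lemma killed_minor s t x y : morph_rank h = n.-1 -> killed s -> killed t ->
  s x * t y = s y * t x.
Proof.
move=> rk ks kt.
pose F := \matrix_(a < k, z < n) fox (monom_val w) a (h z).
have F1 : map_mx (horner_eval 1) F = gamma_mx h.
  by apply/matrixP=> a z; rewrite !mxE; apply: fox_monom_horner1.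
have FE (r : 'I_n -> {poly rat}) a : \sum_x r x * F a x = \sum_x r x * fox (monom_val w) a (h x).
  by apply: eq_bigr => z _; rewrite mxE.
apply: (@corank1_minor_poly _ _ _ F 1); first by rewrite F1 -rk.
  by move=> a; rewrite FE.
by move=> a; rewrite FE.
Qed.

Lemma killed_parallel s t x : killed s -> s x != 0 ->
  (forall y, s x * t y = s y * t x) -> killed t.
Proof.
move=> ks sx st a; apply: (mulfI sx); rewrite mulr0 mulr_sumr.
transitivity (t x * (\sum_y s y * fox (monom_val w) a (h y))); last by rewrite ks mulr0.
rewrite mulr_sumr; apply: eq_bigr => y _.
by rewrite [LHS]mulrA st; ring.
Qed.

Lemma killed_delta x : h x = [::] -> killed (fun y => (y == x)%:R).
Proof.
move=> hx a; rewrite big1 // => y _; have [->|] := eqVneq y x; last by rewrite mul0r.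
by rewrite hx mulr0.
Qed.

(** Erased unknowns give unit vectors as relations, and distinct unit vectors are not
    proportional. *)
Lemma erased_unique x y : morph_rank h = n.-1 -> h x = [::] -> h y = [::] -> x = y.
Proof.
move=> rk /killed_delta kx /killed_delta ky.
have := killed_minor x y rk kx ky; rewrite !eqxx mulr1 eq_sym.
by have [//|_ /eqP] := eqVneq; rewrite mulr0 oner_eq0.
Qed.

Lemma weight_erased_unique : morph_rank h = n.-1 ->
  forall x y, L x = 0%N -> L y = 0%N -> x = y.
Proof. by move=> rk x y /(weight_eq0 w_gt0) hx /(weight_eq0 w_gt0); exact: erased_unique. Qed.

Lemma fox_eq_neq0 E : morph_rank h = n.-1 -> E.1 != E.2 ->
  exists x, fox_eq (monom_val L) E x != 0.
Proof.
move=> rk nE; apply/existsP; apply: contraNT nE => /existsPn fE0.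
apply/eqP/(fox_poly_inj (weight_erased_unique rk)) => x.
by apply/eqP; rewrite -subr_eq0; have := fE0 x; rewrite negbK.
Qed.

(** All relations are proportional to the unit vector at [x], so the Fox vector of [E] vanishes off
    [x]. As [x] has value one, deleting it leaves the other derivatives unchanged, and these
    determine the words. *)
Lemma erased_filter E x : morph_rank h = n.-1 -> h x = [::] -> is_solution_eq h E ->
  filter (predC1 x) E.1 = filter (predC1 x) E.2.
Proof.
move=> rk hx /is_solution_eq_killed kE.
have v1 y : ~~ predC1 x y -> monom_val L y = 1.
  by rewrite negbK => /eqP ->; rewrite /monom_val /L hx /weight big_nil expr0.
apply: (fox_poly_inj (weight_erased_unique rk)) => y.
have [->|nyx] := eqVneq y x.
  by rewrite !fox_notin // mem_filter /= eqxx.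
rewrite !fox_filter //; apply/eqP; rewrite -subr_eq0.
have := killed_minor x y rk (killed_delta hx) kE.
by rewrite eqxx mul1r (negPf nyx) mul0r /fox_eq => ->.
Qed.

End Weighted.

Definition fox_minor (R : comNzRingType) n (v : 'I_n -> R) (E F : equation n) x y : R :=
  fox_eq v E x * fox_eq v F y - fox_eq v E y * fox_eq v F x.

Definition mpoly_at n (L : 'I_n -> nat) : {mpoly rat[n]} -> {poly rat} :=
  mmap (@polyC rat) (monom_val L).

Lemma mpoly_at_fox_minor n (L : 'I_n -> nat) E F x y :
  mpoly_at L (fox_minor (fun i => 'X_i) E F x y) = fox_minor (monom_val L) E F x y.
Proof.
have foxE G z : mpoly_at L (fox_eq (fun i => 'X_i) G z) = fox_eq (monom_val L) G z.
  rewrite /mpoly_at rmorph_fox_eq /fox_eq.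
  by congr (_ - _); apply: eq_fox => i; rewrite /= mmapX mmap1U.
by rewrite /fox_minor -!foxE /mpoly_at rmorphB !rmorphM.
Qed.

Lemma fox_minor_solution n k (h : 'I_n -> seq 'I_k) (w : 'I_k -> nat) E F x y :
  (forall a, 0 < w a)%N -> morph_rank h = n.-1 ->
  is_solution_eq h E -> is_solution_eq h F ->
  mpoly_at (fun x => weight w (h x)) (fox_minor (fun i => 'X_i) E F x y) = 0.
Proof.
move=> w_gt0 rk /(is_solution_eq_killed _ w_gt0) kE /(is_solution_eq_killed _ w_gt0) kF.
by rewrite mpoly_at_fox_minor /fox_minor (killed_minor x y rk kE kF) subrr.
Qed.

Lemma mpoly_at_coef n (L : 'I_n -> nat) p e :
  (mpoly_at L p)`_e = \sum_(m <- msupp p) p@_m * (e == \sum_i L i * m i)%N%:R.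
Proof.
rewrite /mpoly_at /mmap coef_sum; apply: eq_bigr => m _.
rewrite coefCM; congr (_ * _); rewrite /mmap1 /monom_val.
by rewrite (eq_bigr (fun i => 'X^(L i * m i))) => [|i _]; rewrite ?exprM // prodrXr coefXn.
Qed.

End Solutions.

Lemma pairwise_mem (T : eqType) (r : rel T) s x y : ssrbool.symmetric r ->
  pairwise r s -> x \in s -> y \in s -> x != y -> r x y.
Proof.
move=> rC; elim: s => //= z s IHs /andP[/allP rz /IHs{}IHs].
rewrite !in_cons => /predU1P[->|xs] /predU1P[->|ys] xy; first by rewrite eqxx in xy.
- exact: rz.
- by rewrite rC; apply: rz.
- exact: IHs.
Qed.

(** * Regions of a hyperplane arrangement in the open orthant *)

Section Arrangement.
Local Open Scope ring_scope.

Definition dot n (a b : 'rV[rat]_n) : rat := \sum_i a 0 i * b 0 i.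

(** The zero vector is collinear to everything, whence the nonzero hypotheses below. *)
Definition collinear n (a b : 'rV[rat]_n) : bool :=
  [forall i, forall j, a 0 i * b 0 j == a 0 j * b 0 i].

Definition positive n (a : 'rV[rat]_n) : Prop := forall i, 0 < a 0 i.

Lemma dotDl n (a b c : 'rV[rat]_n) : dot (a + b) c = dot a c + dot b c.
Proof. by rewrite -big_split; apply: eq_bigr => i _; rewrite mxE mulrDl. Qed.

Lemma dotZl n x (a c : 'rV[rat]_n) : dot (x *: a) c = x * dot a c.
Proof. by rewrite mulr_sumr; apply: eq_bigr => i _; rewrite mxE mulrA. Qed.

Lemma dotC n (a b : 'rV[rat]_n) : dot a b = dot b a.
Proof. by apply: eq_bigr => i _; rewrite mulrC. Qed.

Lemma dotNr n (a b : 'rV[rat]_n) : dot a (- b) = - dot a b.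
Proof. by rewrite dotC -scaleN1r dotZl mulN1r dotC. Qed.

Lemma dotBr n (a b c : 'rV[rat]_n) : dot a (b - c) = dot a b - dot a c.
Proof. by rewrite dotC dotDl dotC [dot (- _) _]dotC dotNr. Qed.

Lemma dot_deltal n (a : 'rV[rat]_n) i : dot (delta_mx 0 i) a = a 0 i.
Proof.
rewrite /dot (bigD1 i) //= mxE !eqxx mul1r big1 ?addr0 // => j /negPf ji.
by rewrite mxE ji andbF mul0r.
Qed.

Lemma dot_deltar n (a : 'rV[rat]_n) i : dot a (delta_mx 0 i) = a 0 i.
Proof. by rewrite dotC dot_deltal. Qed.

Lemma dot_self_gt0 n (a : 'rV[rat]_n) : a != 0 -> 0 < dot a a.
Proof.
case/rV0Pn => i ai; rewrite /dot (bigD1 i) //= ltr_pwDl //.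
  by rewrite -expr2 exprn_even_gt0.
by apply: sumr_ge0 => j _; rewrite -expr2 sqr_ge0.
Qed.

Lemma collinearP n (a b : 'rV[rat]_n) :
  reflect (forall i j, a 0 i * b 0 j = a 0 j * b 0 i) (collinear a b).
Proof.
apply: (iffP forallP) => [ab i j|ab i]; first exact/eqP/(forallP (ab i)).
by apply/forallP => j; apply/eqP.
Qed.

Lemma collinear_sym n : ssrbool.symmetric (@collinear n).
Proof. by move=> a b; apply/collinearP/collinearP => ab i j; have := ab j i; lra. Qed.

Lemma collinear_dot n (a b c : 'rV[rat]_n) i : collinear a b ->
  dot c a * b 0 i = dot c b * a 0 i.
Proof.
move=> /collinearP ab; rewrite !mulr_suml; apply: eq_bigr => j _.
by rewrite -!mulrA ab; ring.
Qed.

Lemma collinear_dot_eq0 n (a b c : 'rV[rat]_n) : collinear a b -> b != 0 ->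
  dot c b = 0 -> dot c a = 0.
Proof.
move=> ab /rV0Pn[i bi] cb0; apply: (mulIf bi).
by rewrite (collinear_dot c i ab) cb0 !mul0r.
Qed.

Lemma collinear_dot_neq0 n (a b : 'rV[rat]_n) : collinear a b -> a != 0 -> b != 0 ->
  dot b a != 0.
Proof.
move=> ab /rV0Pn[i ai] b0; apply/eqP => ba.
have := collinear_dot b i ab; rewrite ba mul0r => /esym/eqP.
by rewrite mulf_eq0 (negPf ai) orbF gt_eqF // dot_self_gt0.
Qed.

Lemma collinear_trans n (b a c : 'rV[rat]_n) : b != 0 ->
  collinear a b -> collinear c b -> collinear a c.
Proof.
move=> /rV0Pn[k bk] /collinearP ab /collinearP cb; apply/collinearP => i j.
have := ab i k; have := ab j k; have := cb i k; have := cb j k => h1 h2 h3 h4.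
have a_i : a 0 i = a 0 k * b 0 i / b 0 k by rewrite -h4 mulfK.
have a_j : a 0 j = a 0 k * b 0 j / b 0 k by rewrite -h3 mulfK.
have c_i : c 0 i = c 0 k * b 0 i / b 0 k by rewrite -h2 mulfK.
have c_j : c 0 j = c 0 k * b 0 j / b 0 k by rewrite -h1 mulfK.
by rewrite a_i a_j c_i c_j; ring.
Qed.

(** The product is the square of [dot L b] times the sum of [N] and a fixed quotient, so [N] only
    has to exceed finitely many quotients. *)
Lemma perturb n (A : seq 'rV[rat]_n) (L L' : 'rV[rat]_n) :
  exists N : nat, forall b, b \in A -> dot L b != 0 ->
    0 < dot (N%:R *: L + L') b * dot L b.
Proof.
suff [N0 HN] : exists N0 : nat, forall N, (N0 <= N)%N -> forall b, b \in A ->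
    dot L b != 0 -> 0 < dot (N%:R *: L + L') b * dot L b by exists N0; apply: HN.
elim: A => [|a A [N0 IHA]]; first by exists 0%N.
exists (maxn N0 (Num.bound `|dot L' a / dot L a|)) => N.
rewrite geq_max => /andP[N0N boundN] b; rewrite in_cons => /predU1P[->{b}|bA] Lb0.
  have -> : dot (N%:R *: L + L') a * dot L a
      = dot L a ^+ 2 * (N%:R + dot L' a / dot L a).
    by rewrite dotDl dotZl; field.
  rewrite mulr_gt0 ?exprn_even_gt0 //.
  have := archi_boundP (normr_ge0 (dot L' a / dot L a)).
  have := lerNnormlW (lexx `|dot L' a / dot L a|).
  have : (Num.bound `|dot L' a / dot L a|)%:R <= N%:R :> rat by rewrite ler_nat.
  lra.
exact: IHA.
Qed.

(** Each vanishing [dot L a] is repaired by adding some [L'] to a large multiple of [L]. The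
    predicate [V] will stand for all functionals, for those orthogonal to [d], and for those with
    natural coordinates. *)
Lemma generic_positive n (V : 'rV[rat]_n -> Prop) (A : seq 'rV[rat]_n) (L0 : 'rV[rat]_n) :
  (forall (N : nat) a b, V a -> V b -> V (N%:R *: a + b)) ->
  V L0 -> positive L0 ->
  (forall a, a \in A -> exists2 L, V L & dot L a != 0) ->
  exists L, [/\ V L, positive L & forall a, a \in A -> dot L a != 0].
Proof.
move=> Vlin VL0 L0_gt0; elim: A => [|a A IHA] genA; first by exists L0.
have [b bA|L [VL L_gt0 LA]] := IHA; first by apply: genA; rewrite in_cons bA orbT.
have [La|La] := eqVneq (dot L a) 0; last first.
  by exists L; split=> // b; rewrite in_cons => /predU1P[->|/LA].
have [|L' VL' L'a] := genA a; first by rewrite mem_head.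
(* Including the unit vectors makes the perturbation preserve positivity. *)
have [N HN] := perturb (A ++ [seq delta_mx 0 i | i : 'I_n]) L L'.
exists (N%:R *: L + L'); split; first exact: Vlin.
  move=> i; have := HN (delta_mx 0 i).
  rewrite mem_cat orbC image_f // !dot_deltar gt_eqF // => /(_ isT isT).
  by rewrite pmulr_lgt0.
move=> b; rewrite in_cons => /predU1P[->|bA].
  by rewrite dotDl dotZl La mulr0 add0r.
have := HN b; rewrite mem_cat bA LA // => /(_ isT isT).
by apply: contraTneq => ->; rewrite mul0r ltxx.
Qed.

Lemma generic_positive_orth n (d : 'rV[rat]_n) (A : seq 'rV[rat]_n) (L0 : 'rV[rat]_n) :
  dot L0 d = 0 -> positive L0 -> (forall a, a \in A -> ~~ collinear a d) ->
  exists L, [/\ dot L d = 0, positive L & forall a, a \in A -> dot L a != 0].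
Proof.
move=> L0d L0_gt0 Ad.
apply: (@generic_positive _ (fun L => dot L d = 0) _ L0) => // [N a b ad bd|a /Ad].
  by rewrite dotDl dotZl ad bd mulr0 addr0.
case/forallPn => i /forallPn[j nad].
(* This functional kills [d], and its value at [a] is the nonzero minor in columns [i] and [j]. *)
exists (d 0 j *: delta_mx 0 i + (- d 0 i) *: delta_mx 0 j).
  by rewrite dotDl !dotZl !dot_deltal; ring.
by rewrite dotDl !dotZl !dot_deltal; apply: contraNneq nad => e; apply/eqP; lra.
Qed.

Definition separated n (ds : seq 'rV[rat]_n) (L L' : 'rV[rat]_n) : bool :=
  has (fun d => dot L d * dot L' d < 0) ds.

Lemma separated_sym n (ds : seq 'rV[rat]_n) : ssrbool.symmetric (separated ds).
Proof. by move=> L L'; apply: eq_has => d; rewrite mulrC. Qed.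

Lemma mulr_sign_trans (R : realDomainType) (a b c e : R) :
  a * b < 0 -> 0 < c * e -> 0 < a * e -> c * b < 0.
Proof.
move=> ab ce ae; rewrite -(pmulr_llt0 _ ae) -(pmulr_llt0 _ ae).
have -> : c * b * (a * e) * (a * e) = a * b * ((c * e) * (a * e)) by ring.
by rewrite nmulr_rlt0 // mulr_gt0.
Qed.

(* Each new hyperplane meets the open orthant at a point off the previous
   hyperplanes, so it cuts some existing region in two. *)
Lemma arrangement_regions n (ds A : seq 'rV[rat]_n) :
  (forall a, a \in A -> a != 0) ->
  (forall d, d \in ds -> d != 0 /\ exists2 L, positive L & dot L d = 0) ->
  pairwise (fun a b => ~~ collinear a b) ds -> (0 < n)%N ->
  exists Ls : seq 'rV[rat]_n,
    [/\ size Ls = (size ds).+1, forall L, L \in Ls -> positive L,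
        forall L a, L \in Ls -> a \in A ++ ds -> dot L a != 0
      & pairwise (separated ds) Ls].
Proof.
move=> + + + n_gt0; elim: ds A => [|d ds IHds] A A0 dsP /=.
  move=> _; have [|||a /A0 /rV0Pn[i ai]|L [_ L_gt0 LA]] :=
      @generic_positive n (fun _ => True) A (const_mx 1) => //.
  - by move=> i; rewrite mxE ltr01.
  - by exists (delta_mx 0 i) => //; rewrite dot_deltal.
  by exists [:: L]; split=> // [L'|L' a]; rewrite mem_seq1 => /eqP -> //; rewrite cats0; exact: LA.
move=> /andP[/allP d_nc ds_nc].
have [d0 [L0 L0_gt0 L0d]] := dsP d (mem_head _ _).
(* [d] joins the avoided vectors, so that no earlier representative lies on the new hyperplane. *)
have [| | |Ls [sizeLs Ls_gt0 LsA Ls_sep]] := IHds (d :: A).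
- by move=> a; rewrite in_cons => /predU1P[->|/A0].
- by move=> a a_ds; apply: dsP; rewrite in_cons a_ds orbT.
- exact: ds_nc.
have AdsP a : a \in A ++ ds -> a != 0.
  rewrite mem_cat => /orP[/A0//|a_ds].
  by have [] := dsP a; rewrite ?in_cons ?a_ds ?orbT.
have [| | |L1 [L1d L1_gt0 L1A]] :=
  @generic_positive_orth _ d [seq a <- A ++ ds | ~~ collinear a d] L0 => //.
  by move=> a; rewrite mem_filter => /andP[].
have L1ds a : a \in ds -> dot L1 a != 0.
  by move=> a_ds; apply: L1A; rewrite mem_filter mem_cat a_ds orbT collinear_sym d_nc.
(* Up to scaling, moving [L1] slightly along [s *: d] reaches the side of [d] given by the sign of
   [s] without crossing any hyperplane of [ds]. *)
have extend (s : rat) : s != 0 -> exists L2, [/\ positive L2,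
    forall a, a \in d :: A ++ ds -> dot L2 a != 0,
    forall a, a \in ds -> 0 < dot L2 a * dot L1 a & 0 < dot L2 d * s].
  move=> s0; have [N HN] := perturb (A ++ ds ++ [seq delta_mx 0 i | i : 'I_n]) L1 (s *: d).
  have L2d : dot (N%:R *: L1 + s *: d) d = s * dot d d.
    by rewrite dotDl !dotZl L1d mulr0 add0r.
  exists (N%:R *: L1 + s *: d); split.
  - move=> i; have := HN (delta_mx 0 i).
    rewrite !mem_cat image_f // !orbT !dot_deltar gt_eqF // => /(_ isT isT).
    by rewrite pmulr_lgt0.
  - move=> a; rewrite in_cons => /predU1P[->|aA].
      by rewrite L2d mulf_neq0 // gt_eqF // dot_self_gt0.
    have [ad|nad] := boolP (collinear a d).
      rewrite dotDl !dotZl (collinear_dot_eq0 ad d0 L1d) mulr0 add0r.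
      by rewrite mulf_neq0 // collinear_dot_neq0 // AdsP.
    have := HN a; rewrite catA mem_cat aA => /(_ isT).
    have -> : dot L1 a != 0 by apply: L1A; rewrite mem_filter nad.
    by move=> /(_ isT); apply: contraTneq => ->; rewrite mul0r ltxx.
  - by move=> a a_ds; apply: HN; rewrite ?L1ds // !mem_cat a_ds orbT.
  - by rewrite L2d mulrAC -expr2 mulr_gt0 ?dot_self_gt0 // exprn_even_gt0.
have sepS L L' : separated ds L L' -> separated (d :: ds) L L'.
  by rewrite /separated /= => ->; rewrite orbT.
suff [L2 [L2_gt0 L2A L2_sep]] : exists L2, [/\ positive L2,
    forall a, a \in d :: A ++ ds -> dot L2 a != 0 &
    forall L, L \in Ls -> separated (d :: ds) L2 L].
  have AE a : (a \in A ++ d :: ds) = (a \in d :: A ++ ds).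
    by rewrite !(mem_cat, in_cons) orbCA.
  exists (L2 :: Ls); split=> /=; first by rewrite sizeLs.
  - by move=> L; rewrite in_cons => /predU1P[->|/Ls_gt0].
  - move=> L a; rewrite in_cons AE => /predU1P[->|LLs]; first exact: L2A.
    by move=> aA; apply: LsA.
  - by apply/andP; split; [apply/allP|apply: sub_pairwise Ls_sep].
(* If some [L] shares the region of [L1] with respect to [ds], the new point is put on the other
   side of [d] from [L]; otherwise either side is new. *)
have [/hasP[L LLs /allP Lsame]|/hasPn noL] :=
  boolP (has (fun L => all (fun a => 0 < dot L a * dot L1 a) ds) Ls).
- have Ld : dot L d != 0 by apply: LsA; rewrite // mem_head.
  have [|L2 [L2_gt0 L2A L2same L2d]] := extend (- dot L d); first by rewrite oppr_eq0.
  exists L2; split=> // L' L'Ls; have [->|L'L] := eqVneq L' L.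
    by rewrite /separated /=; move: L2d; rewrite mulrN oppr_gt0 => ->.
  have /hasP[a a_ds LL'] := pairwise_mem (separated_sym ds) Ls_sep L'Ls LLs L'L.
  apply/sepS/hasP; exists a => //.
  by apply: (mulr_sign_trans _ (L2same _ a_ds) (Lsame _ a_ds)); rewrite mulrC.
- have [|L2 [L2_gt0 L2A L2same _]] := extend 1; first exact: oner_neq0.
  exists L2; split=> // L LLs; have /allPn[a a_ds La] := noL L LLs.
  apply/sepS/hasP; exists a => //.
  have La0 : dot L a != 0 by apply: LsA; rewrite // in_cons mem_cat a_ds !orbT.
  have LL1 : dot L1 a * dot L a < 0.
    by rewrite mulrC lt_neqAle mulf_neq0 ?L1ds //= leNgt.
  apply: (mulr_sign_trans LL1 (L2same _ a_ds)).
  by rewrite -expr2 exprn_even_gt0 // L1ds.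
Qed.

End Arrangement.

(** * Normal vectors of solutions *)

Section Normals.
Local Open Scope ring_scope.

Definition gamma n k (h : 'I_n -> seq 'I_k) (a : 'I_k) : 'rV[rat]_n := row a (gamma_mx h).

(** A spanning vector of the orthogonal complement of Gamma_h. *)
Definition normal n k (h : 'I_n -> seq 'I_k) (d : 'rV[rat]_n) : Prop :=
  [/\ d != 0, forall a, dot (gamma h a) d = 0
    & forall v, (forall a, dot (gamma h a) v = 0) -> collinear v d].

Lemma exists_normal n k (h : 'I_n -> seq 'I_k) : (0 < n)%N ->
  morph_rank h = n.-1 -> exists d, normal h d.
Proof.
move=> n_gt0 rk.
have /rowV0Pn[d dK d0] : kermx (gamma_mx h)^T != 0.
  by rewrite -mxrank_eq0 mxrank_ker mxrank_tr -/(morph_rank h) rk; lia.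
have dotE v a : dot (gamma h a) v = \sum_x v 0 x * gamma_mx h a x.
  by apply: eq_bigr => x _; rewrite !mxE mulrC.
have dG a : dot (gamma h a) d = 0.
  move/sub_kermxP: dK => /matrixP/(_ 0 a); rewrite !mxE dotE => e.
  by rewrite -[RHS]e; apply: eq_bigr => x _; rewrite !mxE.
exists d; split=> // v vG; apply/collinearP => i j.
apply: (@corank1_minor _ _ _ (gamma_mx h) (v 0) (d 0)) => [|a|a]; rewrite -?dotE //.
by rewrite -rk.
Qed.

Definition mnm_vec n (m : 'X_{1..n}) : 'rV[rat]_n := \row_i (m i)%:R.

Lemma mnm_vec_inj n : injective (@mnm_vec n).
Proof.
move=> m m' mm'; apply/mnmP => i; have /rowP/(_ i) := mm'.
by rewrite !mxE => /eqP; rewrite eqr_nat => /eqP.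
Qed.

Definition mnm_weight n (L : 'I_n -> nat) (m : 'X_{1..n}) : nat := (\sum_i L i * m i)%N.

Lemma weight_count k (w : 'I_k -> nat) u :
  weight w u = (\sum_a w a * count_mem a u)%N.
Proof.
elim: u => [|y u IHu].
  by rewrite /weight big_nil big1 // => a _; rewrite muln0.
rewrite /weight big_cons -/(weight w u) IHu [RHS](eq_bigr (fun a => w a * (y == a) + w a * count_mem a u)%N) => [|a _].
  rewrite big_split /= [X in _ = (X + _)%N](bigD1 y) //= eqxx muln1 [X in _ = (_ + X + _)%N]big1 ?addn0 // => a.
  by rewrite eq_sym => /negPf ->; rewrite muln0.
by rewrite -mulnDr.
Qed.

Lemma mnm_weight_gamma n k (h : 'I_n -> seq 'I_k) (w : 'I_k -> nat) m :
  (mnm_weight (fun x => weight w (h x)) m)%:R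
  = \sum_a (w a)%:R * dot (gamma h a) (mnm_vec m).
Proof.
rewrite /mnm_weight /dot natr_sum; under [RHS]eq_bigr do rewrite mulr_sumr.
rewrite exchange_big /=; apply: eq_bigr => i _.
rewrite weight_count natrM natr_sum mulr_suml; apply: eq_bigr => a _.
by rewrite !mxE natrM mulrA.
Qed.

(** Genericity is applied in the space of weights: each vector to be avoided lists the values of all
    [gamma h a] on one difference of monomials. *)
Lemma generic_weight n k (h : 'I_n -> seq 'I_k) (S : seq 'X_{1..n}) :
  exists2 w : 'I_k -> nat, (forall a, 0 < w a)%N &
  forall m m', m \in S -> m' \in S ->
    mnm_weight (fun x => weight w (h x)) m = mnm_weight (fun x => weight w (h x)) m' ->
    forall a, dot (gamma h a) (mnm_vec m - mnm_vec m') = 0.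
Proof.
pose A := [seq \row_a dot (gamma h a) (mnm_vec m - mnm_vec m') | m <- S, m' <- S].
have [| | |a|W [W_nat W_gt0 WA]] := @generic_positive k
    (fun L => forall a, L 0 a \is a Num.nat) [seq v <- A | v != 0] (const_mx 1).
- move=> N a b aN bN i; rewrite !mxE; apply: rpredD; last exact: bN.
  by apply: rpredM; [exact: natr_nat|exact: aN].
- by move=> a; rewrite mxE; apply: rpred1.
- by move=> a; rewrite mxE ltr01.
- rewrite mem_filter => /andP[/rV0Pn[i ai] _]; exists (delta_mx 0 i); last by rewrite dot_deltal.
  by move=> b; rewrite mxE; apply: natr_nat.
have WE a : (Num.truncn (W 0 a))%:R = W 0 a by apply/eqP; rewrite -natrEtruncn W_nat.
exists (fun a => Num.truncn (W 0 a)) => [a|m m' mS m'S emm' a].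
  by rewrite -(ltr_nat rat) WE W_gt0.
have [|nz] := eqVneq (\row_a dot (gamma h a) (mnm_vec m - mnm_vec m')) 0.
  by move/rowP/(_ a); rewrite !mxE.
suff Wv : dot W (\row_a dot (gamma h a) (mnm_vec m - mnm_vec m')) = 0.
  move: (WA (\row_a dot (gamma h a) (mnm_vec m - mnm_vec m'))).
  rewrite Wv eqxx mem_filter nz => /(_ _)/negP[] //.
  by apply/allpairsP; exists (m, m').
transitivity (\sum_a (W 0 a * dot (gamma h a) (mnm_vec m) - W 0 a * dot (gamma h a) (mnm_vec m'))).
  by apply: eq_bigr => b _; rewrite mxE dotBr mulrBr.
rewrite sumrB; under eq_bigr do rewrite -WE.
rewrite -mnm_weight_gamma emm' mnm_weight_gamma.
by under eq_bigr do rewrite WE; rewrite subrr.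
Qed.

(** Under a generic weight the coefficient at the weight of [m] collects only monomials that differ
    from [m] by a multiple of [d]. It is zero, so [m] is not alone, and [L] cannot tell these
    monomials apart. *)
Lemma no_unique_min n k (h : 'I_n -> seq 'I_k) d (p : {mpoly rat[n]}) (L : 'rV[rat]_n) m :
  normal h d ->
  (forall w : 'I_k -> nat, (forall a, 0 < w a)%N -> mpoly_at (fun x => weight w (h x)) p = 0) ->
  dot L d = 0 -> m \in msupp p ->
  exists m', [/\ m' \in msupp p, m' != m & dot L (mnm_vec m') = dot L (mnm_vec m)].
Proof.
move=> [d0 hd hnd] p0 Ld mp.
have [/hasP[m' m'p /andP[m'm /eqP Lm']]|/hasPn uniq_m] :=
  boolP (has (fun m' => (m' != m) && (dot L (mnm_vec m') == dot L (mnm_vec m))) (msupp p)).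
  by exists m'.
have [w w_gt0 w_gen] := generic_weight h (msupp p).
have /polyP/(_ (mnm_weight (fun x => weight w (h x)) m)) := p0 w w_gt0.
rewrite coef0 mpoly_at_coef (bigD1_seq m) ?msupp_uniq //= -/(mnm_weight _ m) eqxx mulr1.
rewrite big_seq_cond big1 ?addr0 => [/eqP|m' /andP[m'p m'm]].
  by rewrite mcoeff_eq0 mp.
case: eqP; rewrite ?mulr0 // -/(mnm_weight _ m') => /(w_gen _ _ mp m'p) /hnd mm'd.
have := uniq_m m' m'p; rewrite m'm /= => /eqP[].
by have := collinear_dot_eq0 mm'd d0 Ld; rewrite dotBr; lra.
Qed.

(** Vanishing depends only on how the weights partition the support. *)
Lemma mpoly_at_transfer n (L L' : 'I_n -> nat) (p : {mpoly rat[n]}) :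
  (forall m m', m \in msupp p -> m' \in msupp p ->
    (mnm_weight L m == mnm_weight L m') = (mnm_weight L' m == mnm_weight L' m')) ->
  mpoly_at L p = 0 -> mpoly_at L' p = 0.
Proof.
move=> LL' p0; apply/polyP => e; rewrite coef0 mpoly_at_coef.
have [/hasP[m0 m0p /eqP->]|/hasPn noe] :=
    boolP (has (fun m => e == mnm_weight L' m) (msupp p)).
  transitivity ((mpoly_at L p)`_(mnm_weight L m0)); last by rewrite p0 coef0.
  rewrite mpoly_at_coef; apply: eq_big_seq => m mp.
  by rewrite -!/(mnm_weight _ m) LL'.
rewrite big_seq big1 // => m /noe; rewrite -/(mnm_weight L' m) => /negPf ->.
by rewrite mulr0.
Qed.

Lemma normal_gamma_eq0 n k1 k2 (h1 : 'I_n -> seq 'I_k1) (h2 : 'I_n -> seq 'I_k2) d1 d2 v :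
  normal h1 d1 -> normal h2 d2 -> collinear d1 d2 ->
  (forall a, dot (gamma h1 a) v = 0) -> forall a, dot (gamma h2 a) v = 0.
Proof.
move=> [d10 _ hd1] [d20 h2d _] d12 /hd1 vd1 a.
by apply: (collinear_dot_eq0 (b := d2)); rewrite // (collinear_trans d10 vd1) // collinear_sym.
Qed.

Lemma gamma_weight n k (h : 'I_n -> seq 'I_k) (w : 'I_k -> nat) m m' :
  (forall a, dot (gamma h a) (mnm_vec m - mnm_vec m') = 0) ->
  mnm_weight (fun x => weight w (h x)) m = mnm_weight (fun x => weight w (h x)) m'.
Proof.
move=> hmm'; apply/eqP; rewrite -(eqr_nat rat) !mnm_weight_gamma; apply/eqP.
apply: eq_bigr => a _; congr (_ * _); have := hmm' a; rewrite dotBr; lra.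
Qed.

(* The Fox vector of [F] spans the relations of [h1], so that of [E] is parallel
   to it modulo [d1]; parallelism only depends on the normal up to scaling, and
   the Fox vector of [F] is a nonzero relation of [h2] as well. *)
Lemma same_normal_same_solutions n k1 k2 (h1 : 'I_n -> seq 'I_k1) (h2 : 'I_n -> seq 'I_k2)
  d1 d2 (E F : equation n) :
  normal h1 d1 -> normal h2 d2 -> collinear d1 d2 ->
  morph_rank h1 = n.-1 -> morph_rank h2 = n.-1 -> F.1 != F.2 ->
  is_solution_eq h1 F -> is_solution_eq h2 F ->
  is_solution_eq h1 E -> is_solution_eq h2 E.
Proof.
move=> nd1 nd2 d12 rk1 rk2 nF h1F h2F h1E.
pose P x y : {mpoly rat[n]} := fox_minor (fun i => 'X_i) F E x y.
(* One generic weight has to serve the minors for all pairs of columns. *)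
pose S := flatten [seq msupp (P xy.1 xy.2) | xy : 'I_n * 'I_n].
have PS x y m : m \in msupp (P x y) -> m \in S.
  by move=> mP; apply/flattenP; exists (msupp (P x y)) => //; apply/imageP; exists (x, y).
have [w1 w1_gt0 gen1] := generic_weight h1 S.
have [w2 w2_gt0 gen2] := generic_weight h2 S.
have P0 x y : fox_minor (monom_val (fun x => weight w2 (h2 x))) F E x y = 0.
  rewrite -mpoly_at_fox_minor -/(P x y).
  apply: mpoly_at_transfer (fox_minor_solution x y w1_gt0 rk1 h1F h1E) => m m' /PS mS /PS m'S.
  apply/eqP/eqP => [/(gen1 _ _ mS m'S) e|/(gen2 _ _ mS m'S) e]; apply: gamma_weight.
    exact: normal_gamma_eq0 nd1 nd2 d12 e.
  by apply: normal_gamma_eq0 nd2 nd1 _ e; rewrite collinear_sym.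
have [x Fx] := fox_eq_neq0 w2_gt0 rk2 nF.
apply/(is_solution_eq_killed _ w2_gt0).
apply: (killed_parallel (s := fox_eq _ F) _ Fx); first exact/is_solution_eq_killed.
by move=> y; apply/eqP; rewrite -subr_eq0; apply/eqP/P0.
Qed.

End Normals.

(** * Chains of monomials *)

Section Chains.
Local Open Scope ring_scope.

(** Commutative images of the prefixes before the occurrences of [x], that is, the terms of the
    formal Fox derivative. *)
Fixpoint occ_mnm n (x : 'I_n) (w : word n) : seq 'X_{1..n} :=
  if w is y :: w' then
    (if y == x then [:: 0%MM] else [::]) ++ [seq (U_(y) + m)%MM | m <- occ_mnm x w']
  else [::].

Lemma size_occ_mnm n (x : 'I_n) w : size (occ_mnm x w) = count_mem x w.
Proof. by elim: w => //= y w IHw; rewrite size_cat size_map IHw; case: (y == x). Qed.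

Lemma fox_occ_mnm n (x : 'I_n) w :
  fox (fun i => 'X_i) x w = \sum_(m <- occ_mnm x w) 'X_[m] :> {mpoly rat[n]}.
Proof.
elim: w => [|y w IHw] /=; first by rewrite big_nil.
rewrite big_cat big_map /= IHw mulr_sumr; congr (_ + _).
  by case: (y == x); rewrite ?big_nil // big_seq1 mpolyX0.
by apply: eq_bigr => m _; rewrite mpolyXD.
Qed.

Definition mnm_chain n (C : seq 'X_{1..n}) : Prop :=
  {in C &, forall m m', (m <= m')%MM || (m' <= m)%MM}.

Lemma mnm_chain_add n (p : 'X_{1..n}) C :
  mnm_chain C -> mnm_chain [seq (p + m)%MM | m <- C].
Proof.
move=> chC _ _ /mapP[m mC ->] /mapP[m' m'C ->].
have /orP[/mnm_lepP le|/mnm_lepP le] := chC m m' mC m'C.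
  by apply/orP; left; apply/mnm_lepP => i; rewrite !mnmDE leq_add2l.
by apply/orP; right; apply/mnm_lepP => i; rewrite !mnmDE leq_add2l.
Qed.

Lemma occ_mnm_chain n (x : 'I_n) w : mnm_chain (occ_mnm x w).
Proof.
elim: w => [|y w IHw] //= m m'; rewrite !mem_cat.
have le0 (a : 'X_{1..n}) : (0 <= a)%MM by apply/mnm_lepP => i; rewrite mnm0E.
case: (y == x) => /=; last by apply: mnm_chain_add.
rewrite !mem_seq1 => /predU1P[->|mC]; first by rewrite le0.
by move=> /predU1P[->|m'C]; [rewrite le0 orbT|apply: mnm_chain_add IHw _ _ mC m'C].
Qed.

Lemma msupp_fox_eq n (E : equation n) x :
  {subset msupp (fox_eq (fun i => 'X_i) E x : {mpoly rat[n]})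
   <= occ_mnm x E.1 ++ occ_mnm x E.2}.
Proof.
have foxS w : {subset msupp (fox (fun i => 'X_i) x w : {mpoly rat[n]}) <= occ_mnm x w}.
  move=> m; rewrite fox_occ_mnm => /msupp_sum_le /flattenP[s /mapP[m']].
  by rewrite filter_predT => m'x ->; rewrite msuppX mem_seq1 => /eqP ->.
move=> m /msuppB_le; rewrite !mem_cat => /orP[] /foxS -> //.
by rewrite orbT.
Qed.

(** Each term [p] from [E] translates the two chains given by the sides of [F], so the number of
    chains depends on [E] alone. *)
Definition fox_chains n (E F : equation n) x y : seq (seq 'X_{1..n}) :=
  [seq [seq (p + q)%MM | q <- C] | p <- occ_mnm x E.1 ++ occ_mnm x E.2,
                                   C <- [:: occ_mnm y F.1; occ_mnm y F.2]].

Lemma size_fox_chains n (E F : equation n) x y :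
  size (fox_chains E F x y) = (eq_occ E x * 2)%N.
Proof. by rewrite size_allpairs size_cat !size_occ_mnm. Qed.

Lemma fox_chainsP n (E F : equation n) x y C : C \in fox_chains E F x y -> mnm_chain C.
Proof.
move=> /allpairsP[[p C'] [_ C'F ->]]; apply: mnm_chain_add.
by move: C'F; rewrite !inE => /orP[] /eqP ->; apply: occ_mnm_chain.
Qed.

Lemma msupp_fox_chains n (E F : equation n) x y m :
  m \in msupp (fox_eq (fun i => 'X_i) E x * fox_eq (fun i => 'X_i) F y : {mpoly rat[n]}) ->
  exists2 C, C \in fox_chains E F x y & m \in C.
Proof.
move=> /msuppM_le /allpairsP[[p q] /= [/msupp_fox_eq pE /msupp_fox_eq qF ->]].
have [C' C'F qC'] : exists2 C', C' \in [:: occ_mnm y F.1; occ_mnm y F.2] & q \in C'.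
  move: qF; rewrite mem_cat => /orP[qF|qF].
    by exists (occ_mnm y F.1); rewrite // mem_head.
  by exists (occ_mnm y F.2); rewrite // !inE eqxx orbT.
exists [seq (p + q)%MM | q <- C']; last exact: map_f.
by apply/allpairsP; exists (p, C').
Qed.

Lemma seq_argmin (T : eqType) (f : T -> rat) s : s != [::] ->
  exists2 x, x \in s & forall y, y \in s -> f x <= f y.
Proof.
elim: s => // a s IHs _; have [->|/IHs[x xs xmin]] := eqVneq s [::].
  by exists a => [|y]; rewrite mem_seq1 // => /eqP ->.
have [le_ax|/ltW le_xa] := leP (f a) (f x).
  exists a; first exact: mem_head.
  by move=> y; rewrite in_cons => /predU1P[->//|/xmin]; apply: le_trans.
exists x; first by rewrite in_cons xs orbT.
by move=> y; rewrite in_cons => /predU1P[->//|/xmin].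
Qed.

Lemma dot_mnm_le n (L : 'rV[rat]_n) m m' : positive L -> (m <= m')%MM ->
  dot L (mnm_vec m) <= dot L (mnm_vec m').
Proof.
move=> L_gt0 /mnm_lepP mm'; apply: ler_sum => i _.
by rewrite !mxE ler_wpM2l ?ler_nat // ltW.
Qed.

(* A positive functional has at most one minimiser in each chain, and a common
   minimiser of two functionals separated by [d] would be the unique minimiser
   of a positive combination orthogonal to [d]. *)
Lemma normals_lt_chains n (p : {mpoly rat[n]}) (ds : seq 'rV[rat]_n)
  (Cs : seq (seq 'X_{1..n})) :
  (0 < n)%N -> p != 0 ->
  (forall d, d \in ds -> d != 0 /\ exists2 L, positive L & dot L d = 0) ->
  pairwise (fun a b => ~~ collinear a b) ds ->
  (forall d L m, d \in ds -> dot L d = 0 -> m \in msupp p ->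
    exists m', [/\ m' \in msupp p, m' != m & dot L (mnm_vec m') = dot L (mnm_vec m)]) ->
  (forall C, C \in Cs -> mnm_chain C) ->
  (forall m, m \in msupp p -> exists2 C, C \in Cs & m \in C) ->
  (size ds < size Cs)%N.
Proof.
move=> n_gt0 p0 dsP ds_nc no_min Cs_chain Cs_cover.
(* Avoiding these differences makes every functional injective on the support, so its minimiser
   there is unique. *)
pose A := [seq a <- [seq mnm_vec m - mnm_vec m' | m <- msupp p, m' <- msupp p] | a != 0].
have [a|Ls [<- Ls_gt0 LsA Ls_sep]] := @arrangement_regions n ds A _ dsP ds_nc n_gt0.
  by rewrite mem_filter => /andP[].
pose ismin (L : 'rV[rat]_n) m := (m \in msupp p) &&
  all (fun m' => (m' != m) ==> (dot L (mnm_vec m) < dot L (mnm_vec m'))) (msupp p).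
have isminP L m : ismin L m ->
    forall m', m' \in msupp p -> m' != m -> dot L (mnm_vec m) < dot L (mnm_vec m').
  by move=> /andP[_ /allP Lm] m' /Lm /implyP.
have ismin_mem L m : ismin L m -> m \in msupp p by case/andP.
have ismin_ex L : L \in Ls -> exists m, ismin L m.
  move=> LLs; have [|m mp mmin] := @seq_argmin _ (fun m => dot L (mnm_vec m)) (msupp p).
    by rewrite msupp_eq0.
  exists m; rewrite /ismin mp; apply/allP => m' m'p; apply/implyP => m'm.
  rewrite lt_neqAle mmin // andbT eq_sym -subr_eq0 -dotBr LsA // mem_cat mem_filter subr_eq0.
  by rewrite (inj_eq (@mnm_vec_inj n)) m'm; apply/orP; left; apply/allpairsP; exists (m', m).
have ismin_sep L L' m : L \in Ls -> L' \in Ls -> ismin L m -> ismin L' m -> L = L'.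
  move=> LLs L'Ls Lm L'm; apply/eqP/negPn/negP => LL'.
  have /hasP[d d_ds dLL'] := pairwise_mem (@separated_sym n ds) Ls_sep LLs L'Ls LL'.
  have Ld0 : dot L d != 0 by apply: contraTneq dLL' => ->; rewrite mul0r ltxx.
  have L'd0 : dot L' d != 0 by apply: contraTneq dLL' => ->; rewrite mulr0 ltxx.
  (* [dot L d] and [dot L' d] have opposite signs, so the crossed coefficients cancel. *)
  have L2d : dot (`|dot L' d| *: L + `|dot L d| *: L') d = 0.
    rewrite dotDl !dotZl; move: dLL'; case: (ger0P (dot L d)) => Ld;
      case: (ger0P (dot L' d)) => L'd; nra.
  have [m' [m'p m'm]] := no_min d _ m d_ds L2d (ismin_mem _ _ Lm).
  have lt1 := isminP _ _ Lm _ m'p m'm; have lt2 := isminP _ _ L'm _ m'p m'm.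
  rewrite !dotDl !dotZl => /eqP; rewrite gt_eqF // ltrD // ltr_pM2l ?normr_gt0 //.
(* An injection of regions into chains: the index of the first chain through the minimiser. *)
pose f L := find (fun C => has (ismin L) C) Cs.
have has_f L : L \in Ls -> has (fun C => has (ismin L) C) Cs.
  move=> /ismin_ex[m Lm]; have [C CCs mC] := Cs_cover m (ismin_mem _ _ Lm).
  by apply/hasP; exists C => //; apply/hasP; exists m.
have f_inj : {in Ls &, injective f}.
  move=> L L' LLs L'Ls ff'.
  have /hasP[m mC Lm] := nth_find [::] (has_f L LLs).
  have /hasP[m'] := nth_find [::] (has_f L' L'Ls).
  rewrite -/(f L') -ff' => m'C L'm'.
  suff mm' : m = m' by apply: ismin_sep LLs L'Ls Lm _; rewrite mm'.
  apply/eqP; apply/negPn/negP => mm'.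
  have fL : (f L < size Cs)%N by rewrite -has_find has_f.
  have /orP[le|le] := Cs_chain _ (mem_nth [::] fL) m m' mC m'C.
    have := isminP _ _ L'm' _ (ismin_mem _ _ Lm) mm'.
    by rewrite ltNge (dot_mnm_le (Ls_gt0 _ L'Ls)).
  have := isminP _ _ Lm _ (ismin_mem _ _ L'm').
  by rewrite eq_sym ltNge (dot_mnm_le (Ls_gt0 _ LLs)) // => /(_ mm').
have Ls_uniq : uniq Ls.
  rewrite uniq_pairwise; apply: sub_pairwise Ls_sep => L L'.
  apply: contraTneq => ->; apply/hasPn => d _.
  by rewrite -leNgt -expr2 sqr_ge0.
rewrite -(size_map f) -(size_iota 0 (size Cs)); apply: uniq_leq_size.
  by rewrite map_inj_in_uniq.
by move=> _ /mapP[L LLs ->]; rewrite mem_iota /= -has_find has_f.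
Qed.

End Chains.

(** * Solutions erasing an unknown *)

Section Erasing.
Local Open Scope ring_scope.

Lemma occ_mnm_filter n (b : pred 'I_n) (x c : 'I_n) w : b x -> b c ->
  [seq (m : 'X_{1..n}) c | m <- occ_mnm x (filter b w)]
  = [seq (m : 'X_{1..n}) c | m <- occ_mnm x w].
Proof.
move=> bx bc; elim: w => //= y w IHw.
have mapD (s : seq 'X_{1..n}) : [seq (m : 'X_{1..n}) c | m <- [seq (U_(y) + m)%MM | m <- s]]
    = [seq ((y == c) + j)%N | j <- [seq (m : 'X_{1..n}) c | m <- s]].
  by rewrite -!map_comp; apply: eq_map => m /=; rewrite mnmDE mnm1E.
case: ifPn => by_ /=; first by rewrite !map_cat !mapD IHw.
have -> : (y == x) = false by apply: contraNF by_ => /eqP ->.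
have yc : (y == c) = false by apply: contraNF by_ => /eqP ->.
by rewrite mapD yc IHw /= (@eq_map _ _ _ id) ?map_id.
Qed.

Lemma mnm_seq_ext n (s t : seq 'X_{1..n}) : (0 < n)%N ->
  (forall c, [seq (m : 'X_{1..n}) c | m <- s] = [seq (m : 'X_{1..n}) c | m <- t]) -> s = t.
Proof.
case: n s t => // n s t _; elim: s t => [|m s IHs] [|m' t] //= st; try by have := st ord0.
congr (_ :: _); last by apply: IHs => c; case: (st c).
by apply/mnmP => c; case: (st c).
Qed.

Definition erasable n (E : equation n) (x : 'I_n) : Prop :=
  filter (predC1 x) E.1 = filter (predC1 x) E.2.

Section TwoErasable.

Variables (n : nat) (x y : 'I_n).
Hypothesis xy : x != y.

Let X : 'I_n -> {mpoly rat[n]} := fun i => 'X_i.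

(** The exponents of [c] can be read off after erasing whichever of [x] and [y] is not [c], and then
    the two sides agree. *)
Lemma erasable2_fox_eq0 (E : equation n) z : erasable E x -> erasable E y ->
  z != x -> z != y -> fox_eq X E z = 0.
Proof.
move=> Ex Ey zx zy; rewrite /fox_eq !fox_occ_mnm.
suff -> : occ_mnm z E.1 = occ_mnm z E.2 by rewrite subrr.
apply: mnm_seq_ext => [|c]; first exact: leq_ltn_trans (leq0n x) (ltn_ord x).
have [cx|cx] := eqVneq c x.
  by rewrite -(occ_mnm_filter (b := predC1 y)) ?Ey ?occ_mnm_filter //= cx.
by rewrite -(occ_mnm_filter (b := predC1 x)) ?Ex ?occ_mnm_filter.
Qed.

Lemma erasable2_balanced (E : equation n) : erasable E x -> erasable E y ->
  perm_eq E.1 E.2.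
Proof.
move=> Ex Ey; apply/allP => z _; apply/eqP => /=.
have countE t w : z != t -> count_mem z w = count_mem z (filter (predC1 t) w).
  move=> zt; rewrite count_filter; apply: eq_count => i /=.
  by have [->|] := eqVneq i z; rewrite ?zt.
have [zx|zx] := eqVneq z x; last by rewrite (countE x E.1) // Ex -countE.
have zy : z != y by rewrite zx.
by rewrite (countE y E.1) // Ey -countE.
Qed.

(** The fundamental formula, applied to two sides with the same letters; only two terms survive. *)
Lemma erasable2_relation (E : equation n) : erasable E x -> erasable E y ->
  fox_eq X E x * (X x - 1) + fox_eq X E y * (X y - 1) = 0.
Proof.
move=> Ex Ey.
have: \sum_z fox_eq X E z * (X z - 1) = 0.
  under eq_bigr do rewrite /fox_eq mulrBl.
  rewrite sumrB !fox_fundamental /word_val (perm_big _ (erasable2_balanced Ex Ey)).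
  exact: subrr.
rewrite (bigD1 x) //= (bigD1 y) 1?eq_sym //= [X in _ + (_ + X)]big1 ?addr0 // => z.
by move=> /andP[zx zy]; rewrite erasable2_fox_eq0 ?mul0r.
Qed.

Lemma mpolyX_sub1_neq0 z : X z - 1 != 0.
Proof.
apply/eqP => /(congr1 (mcoeff U_(z)%MM)).
rewrite mcoeffB mcoeffX eqxx mcoeff1 mnm1_eq0 subr0 mcoeff0 => /eqP.
by rewrite oner_eq0.
Qed.

(** Both Fox vectors live on the columns [x] and [y] and are orthogonal to ([X x - 1], [X y - 1]),
    hence are proportional. *)
Lemma erasable2_fox_minor0 (E F : equation n) u v :
  erasable E x -> erasable E y -> erasable F x -> erasable F y ->
  fox_minor X E F u v = 0.
Proof.
move=> Ex Ey Fx Fy.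
have Mxy : fox_minor X E F x y = 0.
  apply: (mulIf (mpolyX_sub1_neq0 x)); rewrite mul0r.
  have relE := erasable2_relation Ex Ey; have relF := erasable2_relation Fx Fy.
  transitivity (fox_eq X F y * (fox_eq X E x * (X x - 1) + fox_eq X E y * (X y - 1))
     - fox_eq X E y * (fox_eq X F x * (X x - 1) + fox_eq X F y * (X y - 1))).
    by rewrite /fox_minor; ring.
  by rewrite relE relF !mulr0 subrr.
have outside (G : equation n) z : erasable G x -> erasable G y ->
    [\/ fox_eq X G z = 0, z = x | z = y].
  move=> Gx Gy; have [|zx] := eqVneq z x; first by constructor 2.
  have [|zy] := eqVneq z y; first by constructor 3.
  by constructor 1; apply: erasable2_fox_eq0.
have out2 z : [\/ fox_eq X E z = 0 /\ fox_eq X F z = 0, z = x | z = y].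
  have [Ez|->|->] := outside E z Ex Ey; [|by constructor 2|by constructor 3].
  by have [Fz|->|->] := outside F z Fx Fy; [constructor 1|constructor 2|constructor 3].
have [[Eu Fu]|->|->] := out2 u; first by rewrite /fox_minor Eu Fu !mul0r mulr0 subrr.
  have [[Ev Fv]|->|->//] := out2 v; first by rewrite /fox_minor Ev Fv !mul0r mulr0 subrr.
  by rewrite /fox_minor subrr.
have [[Ev Fv]|->|->] := out2 v; first by rewrite /fox_minor Ev Fv !mul0r mulr0 subrr.
  by rewrite -[LHS]opprK /fox_minor opprB -/(fox_minor X E F x y) Mxy oppr0.
by rewrite /fox_minor subrr.
Qed.

End TwoErasable.

End Erasing.

(** * Counting the normals of common solutions *)

Section Count.
Local Open Scope ring_scope.

Definition common_normal n (E F : equation n) (d : 'rV[rat]_n) : Prop :=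
  exists k (h : 'I_n -> seq 'I_k), [/\ morph_rank h = n.-1,
    is_solution_eq h E, is_solution_eq h F & normal h d].

Lemma common_normalC n (E F : equation n) d : common_normal E F d -> common_normal F E d.
Proof. by move=> [k [h [rk hE hF nd]]]; exists k, h. Qed.

(** Among normals of solutions, these are the ones coming from an erased unknown. *)
Definition axis n (d : 'rV[rat]_n) : bool := [exists z, collinear (delta_mx 0 z) d].

Lemma common_normal_erasable n (E F : equation n) d z :
  common_normal E F d -> collinear (delta_mx 0 z) d -> erasable E z /\ erasable F z.
Proof.
move=> [k [h [rk hE hF [d0 hd _]]]] zd.
suff hz : h z = [::].
  have w_gt0 (a : 'I_k) : (0 < 1)%N by [].
  by split; apply: (erased_filter (h := h) (w := fun => 1%N)).
apply: (@weight_eq0 _ (fun => 1%N)) => //; rewrite weight_count big1 // => a _.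
have := collinear_dot_eq0 zd d0 (hd a).
by rewrite dot_deltar !mxE => /eqP; rewrite pnatr_eq0 => /eqP ->.
Qed.

(** The sum of the [gamma h a] is the vector of lengths of the words [h z], all nonempty when no
    unknown is erased. *)
Lemma common_normal_positive n (E F : equation n) d : common_normal E F d -> ~~ axis d ->
  exists2 L, positive L & dot L d = 0.
Proof.
move=> [k [h [_ _ _ [d0 hd hnd]]]] /existsPn nax.
exists (\sum_a gamma h a) => [z|].
  have -> : (\sum_a gamma h a) 0 z = (weight (fun => 1%N) (h z))%:R.
    rewrite weight_count natr_sum summxE; apply: eq_bigr => a _.
    by rewrite !mxE mul1n.
  rewrite ltr0n lt0n; apply: contra (nax z) => /eqP /weight_eq0 hz.
  by apply: hnd => a; rewrite dot_deltar !mxE hz.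
rewrite /dot; under eq_bigr do rewrite summxE mulr_suml.
by rewrite exchange_big big1 //= => a _; apply: hd.
Qed.

(** Two such normals would make two different unknowns erasable in both equations, and then every
    minor vanishes. *)
Lemma count_axis_le1 n (E F : equation n) x y (ds : seq 'rV[rat]_n) :
  fox_minor (fun i => 'X_i : {mpoly rat[n]}) E F x y != 0 ->
  (forall d, d \in ds -> common_normal E F d) ->
  pairwise (fun a b => ~~ collinear a b) ds -> (count (@axis n) ds <= 1)%N.
Proof.
move=> M0 dsP /(subseq_pairwise (filter_subseq (@axis n) ds)).
rewrite -size_filter; case eq_fs : (filter _ _) => [|a [|b s]] //=.
have [/andP[/existsP[z za] ads] /andP[/existsP[t tb] bds]] :
    (axis a && (a \in ds)) /\ (axis b && (b \in ds)).
  by rewrite -!mem_filter eq_fs !inE !eqxx !orbT.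
have zt_erasable := (common_normal_erasable (dsP a ads) za, common_normal_erasable (dsP b bds) tb).
move=> /andP[/andP[/negP[]]].
have [zt|zt] := eqVneq z t.
  have z0 : delta_mx 0 z != 0 :> 'rV[rat]_n.
    by apply/rV0Pn; exists z; rewrite mxE !eqxx oner_eq0.
  by apply: (collinear_trans z0); rewrite collinear_sym // zt.
have [[Ez Fz] [Et Ft]] := zt_erasable.
by rewrite (erasable2_fox_minor0 zt) ?eqxx in M0.
Qed.

(** The axis normal possibly discarded is made up for by the strict inequality of
    [normals_lt_chains]. *)
Lemma common_normals_bound n (E F : equation n) x y (ds : seq 'rV[rat]_n) :
  fox_minor (fun i => 'X_i : {mpoly rat[n]}) E F x y != 0 ->
  (forall d, d \in ds -> common_normal E F d) ->
  pairwise (fun a b => ~~ collinear a b) ds ->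
  (size ds <= 2 * (eq_occ E x + eq_occ E y))%N.
Proof.
move=> M0 dsP ds_nc; have axis_le1 := count_axis_le1 M0 dsP ds_nc.
have n_gt0 : (0 < n)%N := leq_ltn_trans (leq0n x) (ltn_ord x).
pose ds' := [seq d <- ds | ~~ axis d].
suff : (size ds' < size (fox_chains E F x y ++ fox_chains E F y x))%N.
  rewrite size_cat !size_fox_chains size_filter -(count_predC (@axis n) ds).
  by move: axis_le1; rewrite -[X in (X < _)%N]/(count (predC (@axis n)) ds); lia.
apply: (normals_lt_chains n_gt0 M0) => [d||d L m|C|m].
- rewrite mem_filter => /andP[nax /dsP dP]; split.
    by case: dP => k [h [_ _ _ []]].
  exact: common_normal_positive dP nax.
- exact: subseq_pairwise (filter_subseq _ _) ds_nc.
- rewrite mem_filter => /andP[_ /dsP[k [h [rk hE hF nd]]]]; apply: (no_unique_min nd) => w w_gt0.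
  exact: fox_minor_solution.
- by rewrite mem_cat => /orP[] /fox_chainsP.
- move=> /msuppB_le; rewrite mem_cat => /orP[] /msupp_fox_chains[C CC mC]; exists C => //.
    by rewrite mem_cat CC.
  by rewrite mem_cat CC orbT.
Qed.

Lemma fox_minor_swap (R : comNzRingType) n (v : 'I_n -> R) (E F : equation n) x y :
  fox_minor v F E x y = fox_minor v E F y x.
Proof. by rewrite /fox_minor; ring. Qed.

Lemma fox_minor_opp (R : comNzRingType) n (v : 'I_n -> R) (E F : equation n) x y :
  fox_minor v E F y x = - fox_minor v E F x y.
Proof. by rewrite /fox_minor; ring. Qed.

Lemma not_solution_neq n k (h : 'I_n -> seq 'I_k) (E : equation n) :
  ~ is_solution_eq h E -> E.1 != E.2.
Proof. by move=> nhE; apply/eqP => E12; apply: nhE; rewrite /is_solution_eq E12. Qed.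

(** Were all minors zero, the Fox vector of [E] would be parallel to the nonzero one of [F] at the
    weights of [h], and [h] would solve [E]. *)
Lemma fox_minor_neq0 n k (h : 'I_n -> seq 'I_k) (E F : equation n) :
  morph_rank h = n.-1 -> F.1 != F.2 -> is_solution_eq h F -> ~ is_solution_eq h E ->
  exists x y : 'I_n, (x < y)%N /\ fox_minor (fun i => 'X_i : {mpoly rat[n]}) E F x y != 0.
Proof.
move=> rk nF hF nhE.
have [/existsP[x /existsP[y Mxy]]|noM] := boolP [exists x : 'I_n, [exists y : 'I_n,
    fox_minor (fun i => 'X_i : {mpoly rat[n]}) E F x y != 0]].
  have [lt_xy|lt_yx|eq_xy] := ltngtP x y; first by exists x, y.
    exists y, x; split; first exact: lt_yx.
    by rewrite fox_minor_opp oppr_eq0; exact: Mxy.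
  by rewrite (val_inj eq_xy) /fox_minor subrr eqxx in Mxy.
have M0 x y : fox_minor (fun i => 'X_i : {mpoly rat[n]}) E F x y = 0.
  by apply/eqP; move: noM => /existsPn/(_ x)/existsPn/(_ y); rewrite negbK.
have w_gt0 (a : 'I_k) : (0 < 1)%N by [].
case: nhE; apply/(is_solution_eq_killed _ w_gt0).
have [x Fx] := fox_eq_neq0 w_gt0 rk nF.
apply: (killed_parallel (s := fox_eq _ F) _ Fx); first exact/is_solution_eq_killed.
move=> y; apply/eqP; rewrite -subr_eq0 -/(fox_minor _ F E x y) fox_minor_swap.
by rewrite -mpoly_at_fox_minor M0 /mpoly_at mmap0.
Qed.

End Count.

(** Independence is applied to the subsystem omitting [E j]: a solution of it that fails for the
    whole system fails for [E j]. *)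
Lemma independent_solution n m (E : 'I_m -> equation n) (j : 'I_m) :
  0 < n -> strongly_independent E -> exists d,
  exists k (h : 'I_n -> seq 'I_k), [/\ morph_rank h = n.-1,
    forall i, i != j -> is_solution_eq h (E i), ~ is_solution_eq h (E j) & normal h d].
Proof.
move=> n_gt0 /(_ [set~ j]) [].
  by rewrite properEcard subsetT cardsC1 cardsT card_ord; have := ltn_ord j; lia.
move=> k [h [solE rk nsol]]; have [d nd] := exists_normal n_gt0 rk; exists d, k, h.
have solE' i : i != j -> is_solution_eq h (E i) by move=> ij; apply: solE; rewrite !inE.
split=> // solj; apply: nsol => i _.
by have [->|/solE'] := eqVneq i j.
Qed.

Theorem theorem4p9 (n m : nat) (hn : 2 <= n) (hm : 2 <= m)
  (E : 'I_m -> equation n) (Einj : injective E)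
  (i1 i2 : 'I_m) (hi1 : nat_of_ord i1 = 0) (hi2 : nat_of_ord i2 = 1) :
  strongly_independent E ->
  (m <= eq_len (E i1) + eq_len (E i2) + 2 /\
   exists k l : 'I_n, k < l /\ m <= 2 * (eq_occ (E i1) k + eq_occ (E i1) l) + 2) /\
  (has_solution_of_rank E n.-1 ->
   m <= eq_len (E i1) + eq_len (E i2) + 1 /\
   exists k l : 'I_n, k < l /\ m <= 2 * (eq_occ (E i1) k + eq_occ (E i1) l) + 1).
Proof.
move=> indE; have n_gt0 : 0 < n by apply: leq_trans hn.
have i12 : i1 != i2 by rewrite -val_eqE /= hi1 hi2.
have /fin_all_exists[d dP] : forall j, exists d, exists k (h : 'I_n -> seq 'I_k),
  [/\ morph_rank h = n.-1, forall i, i != j -> is_solution_eq h (E i),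
    ~ is_solution_eq h (E j) & normal h d].
  by move=> j; apply: independent_solution.
have nE j : (E j).1 != (E j).2 by have [k [h [_ _ /not_solution_neq]]] := dP j.
have [x [y [xy Mxy]]] : exists x y : 'I_n, x < y /\
    fox_minor (fun i => 'X_i : {mpoly rat[n]})%R (E i1) (E i2) x y != 0%R.
  have [k [h [rk solE nsol _]]] := dP i1.
  by apply: (fox_minor_neq0 rk (nE i2)) nsol; apply: solE; rewrite eq_sym.
have bound (ds : seq 'rV[rat]_n) : (forall d, d \in ds -> common_normal (E i1) (E i2) d) ->
    pairwise (fun a b => ~~ collinear a b) ds ->
    size ds <= 2 * (eq_occ (E i1) x + eq_occ (E i1) y) /\
    size ds <= eq_len (E i1) + eq_len (E i2).
  move=> dsP ds_nc.
  have bound1 := common_normals_bound Mxy dsP ds_nc.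
  (* The same minor up to sign, with the equations exchanged; adding the two bounds and halving
     gives the one by total length. *)
  have M21 : fox_minor (fun i => 'X_i : {mpoly rat[n]})%R (E i2) (E i1) x y != 0%R.
    by rewrite fox_minor_swap fox_minor_opp oppr_eq0.
  have bound2 := common_normals_bound M21 (fun d dds => common_normalC (dsP d dds)) ds_nc.
  have occ_len (G : equation n) : eq_occ G x + eq_occ G y <= eq_len G.
    have count2 w : count_mem x w + count_mem y w <= size w.
      elim: w => //= z w IHw; have [->|_] := eqVneq z x; last by case: (z == y); lia.
      by rewrite -val_eqE /= ltn_eqF //; lia.
    by rewrite /eq_occ addnACA; apply: leq_add; apply: count2.
  by split=> //; have := occ_len (E i1); have := occ_len (E i2); lia.
(* Solutions omitting neither [E i1] nor [E i2] solve both and yield [m - 2] normals. *)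
pose J := [seq j <- enum 'I_m | (j != i1) && (j != i2)].
have sizeJ : size [seq d j | j <- J] = m - 2.
  have cardJ : size J = #|predC (pred2 i1 i2)|.
    rewrite cardE /J enumT /enum_mem; congr size.
    by apply: eq_filter => j; rewrite !inE negb_or.
  have := cardC (pred2 i1 i2); rewrite card2 i12 card_ord => cardm.
  by rewrite size_map cardJ -[in RHS]cardm addKn.
have dsP e : e \in [seq d j | j <- J] -> common_normal (E i1) (E i2) e.
  case/mapP=> j; rewrite mem_filter => /andP[/andP[j1 j2] _] ->.
  have [k [h [rk solE nsol nd]]] := dP j.
  by exists k, h; split=> //; apply: solE; rewrite eq_sym.
have ds_nc : pairwise (fun a b => ~~ collinear a b) [seq d j | j <- J].
  have Jne j : j \in J -> j != i1 by rewrite mem_filter => /andP[/andP[]].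
  rewrite pairwise_map; apply: (sub_in_pairwise (P := mem J) (r := fun i j => i != j)).
  (* If the normals were collinear, the solution omitting [E j] would inherit [E j] from the one
     omitting [E i]. *)
  - move=> i j /Jne i_1 /Jne j_1 /= ij; apply/negP => dij.
    have [ki [hi [rki solEi _ ndi]]] := dP i; have [kj [hj [rkj solEj nsolj ndj]]] := dP j.
    apply: nsolj; apply: (same_normal_same_solutions ndi ndj dij rki rkj (nE i1)).
    + by apply: solEi; rewrite eq_sym.
    + by apply: solEj; rewrite eq_sym.
    + by apply: solEi; rewrite eq_sym.
  - exact/allP.
  - by rewrite -uniq_pairwise filter_uniq ?enum_uniq.
split; first by have [b1 b2] := bound _ dsP ds_nc; split; [lia|exists x, y; split=> //; lia].
move=> [k0 [h0 [sol0 rk0]]]; have [d0 nd0] := exists_normal n_gt0 rk0.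
have solE0 i : is_solution_eq h0 (E i) by apply: sol0; rewrite inE.
(* The normal of a solution of the whole system is a further one, which makes [m - 1]. *)
have [||b1 b2] := bound (d0 :: [seq d j | j <- J]).
- by move=> e; rewrite in_cons => /predU1P[->|/dsP//]; exists k0, h0.
- rewrite /= ds_nc andbT; apply/allP => _ /mapP[j jJ ->]; apply/negP => d0j.
  have [k [h [rk solE nsol nd]]] := dP j; apply: nsol.
  apply: (same_normal_same_solutions nd0 nd d0j rk0 rk (nE i1)) => //.
  by apply: solE; move: jJ; rewrite mem_filter eq_sym => /andP[/andP[]].
by rewrite /= sizeJ in b1 b2; split; [lia|exists x, y; split=> //; lia].
Qed.
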